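(* Let $A\in\mathbb{R}^{n\times n}$ be a symmetric matrix whose associated signed weighted undirected graph $\mathcal{G}(A)$ is connected and acyclic (a tree), and let $B=\mathbf{e}_1\in\mathbb{R}^n$, so that the only leader is vertex $1$. Let $\mathcal{F}_0=\{1\}$, for $k\ge1$ let $\mathcal{F}_k$ be the set of vertices at distance $k$ from vertex $1$, and let $K$ be the maximum distance of a vertex from vertex $1$; assume the vertices are numbered by increasing distance from vertex $1$, as described in the context. If, for every $k\in[0,K-1]$, all the edges from the vertices in $\mathcal{F}_k$ to the vertices in $\mathcal{F}_{k+1}$ have the same sign, then the pair $(A,B)$ is herdable.
   Context: For integers $k\le n$, $[k,n]$ denotes the integer set $\{k,\dots,n\}$. $\mathbf{e}_1$ is the first canonical basis vector. $\mathcal{G}(A)$ has vertex set $[1,n]$ and an arc $(j,i)$ from $j$ to $i$, of weight $[A]_{ij}$, if and only if $[A]_{ij}\neq0$; for symmetric $A$ it is an undirected graph, and acyclicity excludes self-loops (zero diagonal). The sign of an edge is the sign of its weight. Distance is the minimal length of a walk. Numbering of vertices: the leader is $\mathcal{L}=\{1\}$; with $m_k=|\mathcal{F}_k|$, $\mathcal{F}_1=[2,m_1+1]$, $\mathcal{F}_2=[m_1+2,m_1+m_2+1]$, and so on up to $\mathcal{F}_K=[m_1+\cdots+m_{K-1}+2,n]$. Herdability: the pair $(A,B)$ describes the linear time-invariant system $\dot{\mathbf{x}}(t)=A\mathbf{x}(t)+B\mathbf{u}(t)$ (or its discrete-time counterpart $\mathbf{x}(t+1)=A\mathbf{x}(t)+B\mathbf{u}(t)$).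 The pair is (completely) herdable if for every $\mathbf{x}(0)$ and every $h>0$ there exist a time $t_f>0$ and an input $\mathbf{u}(t)$, $t\in[0,t_f)$, driving the state from $\mathbf{x}(0)$ to some $\mathbf{x}(t_f)\ge h\mathbf{1}_n$ (entrywise, $\mathbf{1}_n$ the all-ones vector). It is known that (in both continuous and discrete time) this is equivalent to the image (column space) of the controllability matrix $[B\,|\,AB\,|\,\cdots\,|\,A^{n-1}B]$ containing a vector all of whose entries are positive. *)

(* Defs.v *)
From HB Require Import structures.
From mathcomp Require Import all_boot all_order all_algebra.
From mathcomp Require Import all_classical all_reals all_analysis.

Set Implicit Arguments.
Unset Strict Implicit.
Unset Printing Implicit Defensive.

Import Order.TTheory GRing.Theory Num.Theory.
Import numFieldNormedType.Exports.

Local Open Scope classical_set_scope.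
Local Open Scope ring_scope.

(* The relation [e x y] reads "there is an arc from x to y"; the arc (j, i) has
   weight A i j. *)
Definition mx_graph (R : realType) (n : nat) (A : 'M[R]_n) : rel 'I_n :=
  fun j i => A i j != 0.

Definition graph_connected (T : finType) (e : rel T) : Prop :=
  forall x y : T, connect e x y.

(* For a symmetric relation.  A sequence of two distinct adjacent vertices
   traverses the same edge back and forth and is not a cycle. *)
Definition graph_acyclic (T : finType) (e : rel T) : Prop :=
  irreflexive e /\ (forall c : seq T, (2 < size c)%N -> ~ ucycle e c).

Definition has_walk (T : finType) (e : rel T) (x y : T) (k : nat) : bool :=
  [exists p : k.-tuple T, path e x p && (last x p == y)].

(* The minimal length of a walk from x to y.  A shortest walk does not repeat
   vertices, so only lengths below #|T| need to be searched; the value is #|T|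
   when there is no walk from x to y. *)
Definition graph_dist (T : finType) (e : rel T) (x y : T) : nat :=
  find (has_walk e x y) (iota 0 #|T|).

Definition layer (T : finType) (e : rel T) (r : T) (k : nat) : {set T} :=
  [set v | graph_dist e r v == k]%SET.

Definition graph_height (T : finType) (e : rel T) (r : T) : nat :=
  \max_(v : T) graph_dist e r v.

(* Indices are shifted by one: with s = m_1 + ... + m_(k-1), the 1-based
   interval [s + 2, s + m_k + 1] is [s + 1, s + m_k] in 'I_n.+1. *)
Definition numbered_by_distance (n : nat) (e : rel 'I_n.+1) : Prop :=
  let m l := #|layer e ord0 l| in
  forall k : nat, (1 <= k <= graph_height e ord0)%N ->
    layer e ord0 k =
      [set i : 'I_n.+1 |
        (\sum_(1 <= l < k) m l + 1 <= i <= \sum_(1 <= l < k) m l + m k)%N]%SET.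

(* Inputs are continuous and states are classical solutions on [0, tf]. *)
Definition ct_trajectory (R : realType) (n m : nat) (A : 'M[R]_n)
    (B : 'M[R]_(n, m)) (tf : R) (u : R -> 'cV[R]_m) (x : R -> 'cV[R]_n) : Prop :=
  [/\ {within `[0, tf], continuous u},
      {within `[0, tf], continuous x} &
      forall t : R, 0 < t < tf -> is_derive t 1 x (A *m x t + B *m u t)].

Definition ct_herdable (R : realType) (n m : nat) (A : 'M[R]_n)
    (B : 'M[R]_(n, m)) : Prop :=
  forall (x0 : 'cV[R]_n) (h : R), 0 < h ->
    exists (tf : R) (u : R -> 'cV[R]_m) (x : R -> 'cV[R]_n),
      [/\ 0 < tf, ct_trajectory A B tf u x, x 0 = x0 &
          forall i : 'I_n, h <= x tf i 0].

Definition dt_trajectory (R : realType) (n m : nat) (A : 'M[R]_n)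
    (B : 'M[R]_(n, m)) (tf : nat) (u : nat -> 'cV[R]_m)
    (x : nat -> 'cV[R]_n) : Prop :=
  forall t : nat, (t < tf)%N -> x t.+1 = A *m x t + B *m u t.

Definition dt_herdable (R : realType) (n m : nat) (A : 'M[R]_n)
    (B : 'M[R]_(n, m)) : Prop :=
  forall (x0 : 'cV[R]_n) (h : R), 0 < h ->
    exists (tf : nat) (u : nat -> 'cV[R]_m) (x : nat -> 'cV[R]_n),
      [/\ (0 < tf)%N, dt_trajectory A B tf u x, x 0%N = x0 &
          forall i : 'I_n, h <= x tf i 0].

(* Main.v *)
Require Import Defs.
From HB Require Import structures.
From mathcomp Require Import all_boot all_order all_algebra.
From mathcomp Require Import all_classical all_reals all_analysis.
From mathcomp Require Import zify.

Set Implicit Arguments.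
Unset Strict Implicit.
Unset Printing Implicit Defensive.

Import Order.TTheory GRing.Theory Num.Theory.
Import numFieldNormedType.Exports.

Local Open Scope ring_scope.

(** Write e for the leader's basis vector and n+1 for the number of vertices.
    The entry of A^k e at a vertex is the sum, over the walks of length k from
    the leader to that vertex, of the products of the weights.  Hence A^k e
    vanishes beyond layer k, and on layer k only shortest walks contribute;
    they all run through consecutive layers, so that the sign of each of these
    products is that of a product of one edge sign per layer.  Thus A^k e is
    nonzero with a constant sign on layer k ([powM_layer_sign]).  This is a
    triangular situation: starting from the farthest layer and moving towards
    the leader, a suitable multiple of A^k e makes layer k positive and does
    not touch the layers beyond it ([layered_positive]).  The result is a
    polynomial q such that q(A) e has only positive entries, that is, a
    positive vector in the image of the controllability matrix.

    It remains to pass from such a vector to herdability.  In either time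
    model it is enough to reach (free evolution of x0) + a q(A) e for every
    scalar a, since a large a beats any free evolution and any threshold.
    In discrete time the coefficients of a q, read in Horner order, are the
    inputs ([dt_reach_horner]).

    In continuous time the free evolution is the exponential power series
    ([flow]).  The forced part must go from 0 to a prescribed vector
    q(A) e in unit time.  If c is the characteristic polynomial of A, every
    polynomial p yields a trajectory whose coordinates along the A^k e are
    explicit combinations of p and its derivatives: p is a flat output, and
    Cayley-Hamilton closes the system ([is_derive_flat_state]).  For
    p = X^(n+1) (X-1)^m the trajectory starts at 0 and ends at a nonzero
    multiple of A^(n-m) e plus lower powers applied to e, so that all
    A^k e are reached by induction on k ([steerable_pow]). *)

(** * Derivatives of matrix-valued functions *)

Lemma is_derive_mx (R : realFieldType) (V : normedModType R) (m n : nat)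
    (M : V -> 'M[R]_(m, n)) (D : 'M[R]_(m, n)) (t v : V) :
  (forall i j, is_derive t v (fun s => M s i j) (D i j)) ->
  is_derive t v M D.
Proof.
move=> dM.
have derM : derivable M t v by apply/derivable_mxP => i j; case: (dM i j).
apply: DeriveDef => //; rewrite derive_mx //; apply/matrixP => i j.
by rewrite mxE; case: (dM i j).
Qed.

Lemma is_derive_scalar_mx (R : realFieldType) (V : normedModType R) (m n : nat)
    (f : V -> R) (df : R) (t v : V) (M : 'M[R]_(m, n)) :
  is_derive t v f df -> is_derive t v (fun s => f s *: M) (df *: M).
Proof.
move=> Df; apply: is_derive_mx => i j.
have -> : (fun s => (f s *: M) i j) = M i j \*: f.
  by apply/funext => s /=; rewrite mxE mulrC.
by rewrite mxE mulrC; exact: is_deriveZ.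
Qed.

Lemma is_derive_continuous (R : realType) (V : normedModType R)
    (f df : R -> V) :
  (forall t : R, is_derive t 1 f (df t)) -> continuous f.
Proof.
move=> Df t; apply/differentiable_continuous/derivable1_diffP.
by case: (Df t).
Qed.

(** * Free motion *)

(** A geometric bound in k, by which the exponential series of A applied to v is
    dominated entrywise by a scalar exponential series. *)
Lemma entry_powM_le (R : realFieldType) (n : nat) (A : 'M[R]_n.+1)
    (v : 'cV[R]_n.+1) (k : nat) (i : 'I_n.+1) :
  `|(A ^+ k *m v) i 0|
    <= (\sum_j `|v j 0|) * (\sum_i' \sum_j `|A i' j|) ^+ k.
Proof.
elim: k i => [|k IHk] i.
  rewrite expr0 mul1mx mulr1 (bigD1 i) //= lerDl.
  by apply: sumr_ge0 => ? _; exact: normr_ge0.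
rewrite exprS -mulmxA mxE; apply: le_trans (ler_norm_sum _ _ _) _.
set C := \sum_j `|v j 0| in IHk *; set M := \sum_i' \sum_j `|A i' j| in IHk *.
have C0 : 0 <= C by apply: sumr_ge0 => ? _; exact: normr_ge0.
have M0 : 0 <= M by apply: sumr_ge0 => ? _; apply: sumr_ge0 => ? _; exact: normr_ge0.
rewrite exprS mulrCA.
apply: (@le_trans _ _ ((\sum_j `|A i j|) * (C * M ^+ k))).
  by rewrite mulr_suml; apply: ler_sum => j _; rewrite normrM ler_wpM2l.
apply: ler_wpM2r; first by rewrite mulr_ge0 ?exprn_ge0.
rewrite /M [leRHS](bigD1 i) //= lerDl.
by apply: sumr_ge0 => ? _; apply: sumr_ge0 => ? _; exact: normr_ge0.
Qed.

(** The Taylor coefficients at 0 of the i-th entry of exp(tA) v. *)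
Definition flow_coef (R : realType) (n : nat) (A : 'M[R]_n.+1)
    (v : 'cV[R]_n.+1) (i : 'I_n.+1) : R^nat :=
  fun k => k`!%:R^-1 * (A ^+ k *m v) i 0.

(** Formal differentiation stays in the family, with A v in place of v.  The
    convergence of the derived series, needed to differentiate term by term, is
    therefore an instance of the convergence of the original ones. *)
Lemma pseries_diffs_flow_coef (R : realType) (n : nat) (A : 'M[R]_n.+1)
    (v : 'cV[R]_n.+1) (i : 'I_n.+1) :
  pseries_diffs (flow_coef A v i) = flow_coef A (A *m v) i.
Proof.
apply/funext => k; rewrite /pseries_diffs /flow_coef exprSr -mulmxA mulrA.
by rewrite factS natrM invfM mulrA divff ?mul1r // pnatr_eq0.
Qed.

Lemma is_cvg_flow (R : realType) (n : nat) (A : 'M[R]_n.+1)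
    (v : 'cV[R]_n.+1) (i : 'I_n.+1) (t : R) :
  cvgn (pseries (flow_coef A v i) t).
Proof.
set C := \sum_j `|v j 0|; set M := \sum_i' \sum_j `|A i' j|.
have C0 : 0 <= C by apply: sumr_ge0 => ? _; exact: normr_ge0.
have M0 : 0 <= M by apply: sumr_ge0 => ? _; apply: sumr_ge0 => ? _; exact: normr_ge0.
apply: normed_cvg.
apply: (@series_le_cvg _ _ (C *: exp_coeff (M * `|t|))) => [k|k|k|].
- exact: normr_ge0.
- by rewrite mulr_ge0 // divr_ge0 // exprn_ge0 // mulr_ge0.
- rewrite /= /flow_coef !normrM normfV normrX normr_nat.
  rewrite -mulrA mulrC -[leRHS]/(C * ((M * `|t|) ^+ k / k`!%:R)) exprMn.
  rewrite [leRHS]mulrA; apply: ler_wpM2r; first by rewrite invr_ge0.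
  rewrite [leRHS]mulrA; apply: ler_wpM2r; first by rewrite exprn_ge0.
  exact: entry_powM_le.
exact/is_cvg_seriesZ/is_cvg_series_exp_coeff.
Qed.

(** The vector exp(tA) v. *)
Definition flow (R : realType) (n : nat) (A : 'M[R]_n.+1)
    (v : 'cV[R]_n.+1) (t : R) : 'cV[R]_n.+1 :=
  \col_i limn (pseries (flow_coef A v i) t).

Lemma flow0 (R : realType) (n : nat) (A : 'M[R]_n.+1) (v : 'cV[R]_n.+1) :
  flow A v 0 = v.
Proof.
apply/colP => i; rewrite mxE; apply/cvg_lim => //.
rewrite -(cvg_shiftn 1) /=; apply: cvg_near_cst; apply: nearW => N.
rewrite /pseries /series /= addn1 big_nat_recl //= big1 => [|k _].
  by rewrite addr0 /flow_coef expr0 fact0 invr1 !mulr1 mul1r mul1mx.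
by rewrite expr0n mulr0.
Qed.

Lemma mulmx_flow (R : realType) (n : nat) (A : 'M[R]_n.+1)
    (v : 'cV[R]_n.+1) (t : R) :
  A *m flow A v t = flow A (A *m v) t.
Proof.
apply/colP => i; rewrite !mxE; apply/esym/cvg_lim => //.
have -> : pseries (flow_coef A (A *m v) i) t
    = fun N => \sum_j A i j * pseries (flow_coef A v j) t N.
  apply/funext => N; rewrite /pseries /series /=.
  under [RHS]eq_bigr do rewrite mulr_sumr.
  rewrite exchange_big; apply: eq_bigr => k _ /=.
  rewrite /flow_coef; have -> : A ^+ k *m (A *m v) = A *m (A ^+ k *m v).
    by rewrite !mulmxA -[A ^+ k *m A]/(A ^+ k * A) -exprSr exprS.
  rewrite mxE mulr_sumr mulr_suml.
  by apply: eq_bigr => j _; rewrite [RHS]mulrA mulrCA.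
apply: (cvg_big add_continuous) => j _; rewrite mxE.
by apply: cvgMr; exact: is_cvg_flow.
Qed.

Lemma is_derive_flow (R : realType) (n : nat) (A : 'M[R]_n.+1)
    (v : 'cV[R]_n.+1) (t : R) :
  is_derive t 1 (flow A v) (A *m flow A v t).
Proof.
rewrite mulmx_flow; apply: is_derive_mx => i j.
rewrite mxE -pseries_diffs_flow_coef.
have -> : (fun s => flow A v s i j) = (fun s => limn (pseries (flow_coef A v i) s)).
  by apply/funext => s; rewrite mxE.
apply: (@pseries_snd_diffs _ _ (`|t| + 1)); rewrite ?pseries_diffs_flow_coef;
  try exact: is_cvg_flow.
by rewrite [ltRHS]ger0_norm ?ltrDl // addr_ge0.
Qed.

(** * Forced motion by flatness *)

(** Differentiating q (X - a)^m lowers the exponent by one and replaces q by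
    q' (X - a) + m q, whose value at a is m q(a): whence the factorial, after m
    steps. *)
Lemma derivn_root (R : comNzRingType) (q : {poly R}) (a : R) (m l : nat) :
  (l <= m)%N ->
  ((q * ('X - a%:P) ^+ m)^`(l)).[a] = if l == m then q.[a] *+ m`! else 0.
Proof.
elim: l m q => [|l IHl] [|m] q // lem.
- by rewrite expr0 mulr1.
- by rewrite exprS hornerM hornerM hornerXsubC subrr mul0r mulr0.
have dq : (q * ('X - a%:P) ^+ m.+1)^`()
    = (q^`() * ('X - a%:P) + q *+ m.+1) * ('X - a%:P) ^+ m.
  rewrite derivM deriv_exp derivXsubC mul1r mulrDl exprS mulrA.
  by rewrite mulrnAl mulrnAr.
rewrite derivSn dq IHl // eqSS; case: eqP => // _.
by rewrite !hornerE subrr mulr0 add0r hornerMn -mulrnA factS.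
Qed.

Lemma horner_mxE (R : comNzRingType) (n : nat) (A : 'M[R]_n.+1)
    (p : {poly R}) : horner_mx A p = \sum_(k < size p) p`_k *: A ^+ k.
Proof.
rewrite -{1}[p]coefK poly_def linear_sum; apply: eq_bigr => k _.
by rewrite linearZ /= rmorphXn /= horner_mx_X.
Qed.

(** For a system annihilated by c with flat output p, the index k.+1 gives the
    coordinate of the state along A^k b, and the index 0 gives the input, which
    is c(d/dt) p.  This shift makes a single recurrence cover both. *)
Definition flat_coord (R : nzRingType) (c p : {poly R}) (k : nat) : {poly R} :=
  \sum_(k <= j < size c) c`_j *: p^`(j - k).

Lemma flat_coordS (R : nzRingType) (c p : {poly R}) (k : nat) :
  flat_coord c p k = c`_k *: p + (flat_coord c p k.+1)^`().
Proof.
rewrite /flat_coord; have [lec|ltc] := leqP (size c) k.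
  by rewrite !big_geq ?(leqW lec) // nth_default // scale0r deriv0 addr0.
rewrite big_ltn // subnn derivn0 linear_sum /=; congr (_ + _).
rewrite !big_seq; apply: eq_bigr => j; rewrite mem_index_iota => /andP[ltj _].
by rewrite linearZ /= -derivnS subnSK.
Qed.

Definition flat_state (R : comNzRingType) (n : nat) (A : 'M[R]_n.+1)
    (b : 'cV[R]_n.+1) (c p : {poly R}) (t : R) : 'cV[R]_n.+1 :=
  \sum_(k < size c) (flat_coord c p k.+1).[t] *: (A ^+ k *m b).

(** By [flat_coordS] the derivative of coordinate k.+1 is coordinate k minus
    c_k p.  The coordinates k shift the state to A times itself, with the input
    entering at k = 0; the terms c_k p add up to p c(A) b = 0. *)
Lemma is_derive_flat_state (R : realType) (n : nat) (A : 'M[R]_n.+1)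
    (b : 'cV[R]_n.+1) (c p : {poly R}) (t : R) :
  horner_mx A c = 0 ->
  is_derive t 1 (flat_state A b c p)
    (A *m flat_state A b c p t + (flat_coord c p 0).[t] *: b).
Proof.
move=> cA0.
have -> : flat_state A b c p = \sum_(k < size c)
    (fun s => (flat_coord c p k.+1).[s] *: (A ^+ k *m b)).
  by apply/funext => s; rewrite fct_sumE.
have -> : A *m (\sum_(k < size c)
      (fun s => (flat_coord c p k.+1).[s] *: (A ^+ k *m b))) t
    + (flat_coord c p 0).[t] *: b
    = \sum_(k < size c) ((flat_coord c p k.+1)^`()).[t] *: (A ^+ k *m b).
  have dk k : ((flat_coord c p k.+1)^`()).[t] *: (A ^+ k *m b)
      = (flat_coord c p k).[t] *: (A ^+ k *m b)
        - p.[t] *: ((c`_k *: A ^+ k) *m b).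
    rewrite (flat_coordS _ _ k) hornerD hornerZ scalerDl -scalemxAl scalerA.
    by rewrite [p.[t] * _]mulrC addrAC subrr add0r.
  under [RHS]eq_bigr do rewrite dk.
  rewrite sumrB -scaler_sumr -mulmx_suml -horner_mxE cA0 mul0mx scaler0 subr0.
  have top : flat_coord c p (size c) = 0 by rewrite /flat_coord big_geq.
  rewrite fct_sumE mulmx_sumr addrC.
  rewrite -(big_mkord xpredT (fun k => (flat_coord c p k).[t] *: (A ^+ k *m b))).
  have -> : \sum_(0 <= k < size c) (flat_coord c p k).[t] *: (A ^+ k *m b)
     = \sum_(0 <= k < (size c).+1) (flat_coord c p k).[t] *: (A ^+ k *m b).
    by rewrite [RHS]big_nat_recr //= top horner0 scale0r addr0.
  rewrite big_nat_recl // expr0 mul1mx big_mkord; congr (_ + _).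
  by apply: eq_bigr => k _; rewrite -scalemxAr exprS -mulmxA.
apply: is_derive_sum => k; exact: is_derive_scalar_mx.
Qed.

(** Reachability of v from the origin in unit time, for a scalar input.  Unlike
    a trajectory over an interval, the motion is defined for all times, which
    avoids one-sided derivatives. *)
Definition steerable (R : realType) (n : nat) (A : 'M[R]_n)
    (b v : 'cV[R]_n) : Prop :=
  exists (u : R -> R) (z : R -> 'cV[R]_n),
    [/\ continuous u,
        forall t : R, is_derive t 1 z (A *m z t + u t *: b),
        z 0 = 0 & z 1 = v].

Lemma steerableD (R : realType) (n : nat) (A : 'M[R]_n) (b v w : 'cV[R]_n) :
  steerable A b v -> steerable A b w -> steerable A b (v + w).
Proof.
move=> [u [z [uC zD z0 z1]]] [u' [z' [uC' zD' z0' z1']]].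
have zz s : (z + z') s = z s + z' s by [].
have uu s : (u + u') s = u s + u' s by [].
exists (u + u'), (z + z'); split.
- by move=> t; apply: continuousD; [exact: uC|exact: uC'].
- move=> t; rewrite zz uu mulmxDr scalerDl addrACA; exact: is_deriveD.
- by rewrite zz z0 z0' addr0.
- by rewrite zz z1 z1'.
Qed.

Lemma steerableZ (R : realType) (n : nat) (A : 'M[R]_n) (b v : 'cV[R]_n)
    (a : R) : steerable A b v -> steerable A b (a *: v).
Proof.
move=> [u [z [uC zD z0 z1]]]; exists (a \*: u), (a \*: z); split.
- by move=> t; apply: continuousZr; exact: uC.
- move=> t /=.
  have -> : A *m (a *: z t) + (a * u t) *: b = a *: (A *m z t + u t *: b).
    by rewrite -scalemxAr scalerDr scalerA.
  exact: is_deriveZ.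
- by rewrite /= z0 scaler0.
- by rewrite /= z1.
Qed.

Lemma steerable0 (R : realType) (n : nat) (A : 'M[R]_n) (b : 'cV[R]_n) :
  steerable A b 0.
Proof.
exists (cst 0), (cst 0); split => // [|t]; first exact: cst_continuous.
by rewrite /= mulmx0 scale0r addr0; exact: is_derive_cst.
Qed.

Lemma steerable_sum (R : realType) (n : nat) (A : 'M[R]_n) (b : 'cV[R]_n)
    (I : Type) (r : seq I) (P : pred I) (F : I -> 'cV[R]_n) :
  (forall i, P i -> steerable A b (F i)) ->
  steerable A b (\sum_(i <- r | P i) F i).
Proof.
by move=> HF; apply: big_ind => //; [exact: steerable0|exact: steerableD].
Qed.

(** The flat output X^(n+1) (X-1)^m with m = n - k has zero derivatives up to
    order n at 0 and up to order m - 1 at 1, and a derivative of order m at 1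
    that is not zero.  The coordinate of the state along A^l b involves
    derivatives of order at most n - l: it vanishes at time 0, and at time 1 if
    l > k.  For l = k only the leading coefficient of the characteristic
    polynomial contributes, so the final state is m! A^k b plus lower powers. *)
Lemma steerable_pow (R : realType) (n : nat) (A : 'M[R]_n.+1)
    (b : 'cV[R]_n.+1) (k : nat) :
  (k <= n)%N -> steerable A b (A ^+ k *m b).
Proof.
elim/ltn_ind: k => k IHk lekn; set c := char_poly A; set m := (n - k)%N.
pose p : {poly R} := 'X ^+ n.+1 * ('X - 1%:P) ^+ m.
have szc : size c = n.+2 by rewrite size_char_poly.
have cn1 : c`_n.+1 = 1.
  by have /monicP := char_poly_monic A; rewrite lead_coefE size_char_poly.
(* The start is a root of order n+1, larger than any derivative involved. *)
have p0 : p = ('X - 1%:P) ^+ m * ('X - 0%:P) ^+ n.+1 by rewrite subr0 mulrC.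
have start l : (flat_coord c p l.+1).[0] = 0.
  rewrite /flat_coord horner_sum big_seq big1 // => j.
  rewrite mem_index_iota szc => /andP[lej ltj].
  rewrite hornerZ p0 derivn_root; last by lia.
  by rewrite ifN ?mulr0 //; apply/eqP; lia.
have finish_gt l : (k < l)%N -> (flat_coord c p l.+1).[1] = 0.
  move=> ltkl; rewrite /flat_coord horner_sum big_seq big1 // => j.
  rewrite mem_index_iota szc => /andP[lej ltj].
  rewrite hornerZ derivn_root; last by rewrite /m; lia.
  by rewrite ifN ?mulr0 // /m; apply/eqP; lia.
have finish_eq : (flat_coord c p k.+1).[1] = m`!%:R.
  rewrite /flat_coord szc big_nat_recr //= hornerD horner_sum big_seq big1 => [|j].
    rewrite add0r cn1 scale1r subSS derivn_root // eqxx.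
    by rewrite hornerXn expr1n.
  rewrite mem_index_iota => /andP[lej ltj].
  rewrite hornerZ derivn_root; last by rewrite /m; lia.
  by rewrite ifN ?mulr0 // /m; apply/eqP; lia.
have ltk : (k < size c)%N by rewrite szc; lia.
have steer1 : steerable A b (flat_state A b c p 1).
  exists (horner (flat_coord c p 0)), (flat_state A b c p); split => //.
  - exact: continuous_horner.
  - by move=> t; apply: is_derive_flat_state; exact: Cayley_Hamilton.
  - by rewrite /flat_state big1 // => l _; rewrite start scale0r.
pose other := \sum_(l < size c | l != Ordinal ltk)
  (flat_coord c p l.+1).[1] *: (A ^+ l *m b).
have -> : A ^+ k *m b = m`!%:R^-1 *: (flat_state A b c p 1 + (-1) *: other).
  rewrite /flat_state (bigD1 (Ordinal ltk)) //= -/other finish_eq.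
  by rewrite scaleN1r addrK scalerA mulVf ?scale1r //.
apply/steerableZ/steerableD/steerableZ => //.
apply: steerable_sum => l neq_lk; have [ltl|gtl|eql] := ltngtP l k.
- by apply/steerableZ/IHk => //; lia.
- by rewrite finish_gt // scale0r; exact: steerable0.
- by case/eqP: neq_lk; apply: val_inj.
Qed.

Lemma steerable_horner (R : realType) (n : nat) (A : 'M[R]_n.+1)
    (b : 'cV[R]_n.+1) (q : {poly R}) :
  steerable A b (horner_mx A q *m b).
Proof.
rewrite (divp_eq q (char_poly A)) rmorphD rmorphM /= Cayley_Hamilton mulr0 add0r.
rewrite horner_mxE mulmx_suml; apply: steerable_sum => k _.
rewrite -scalemxAl; apply/steerableZ/steerable_pow; rewrite -ltnS.
apply: leq_trans (ltn_ord k) _; rewrite -ltnS -(size_char_poly A).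
by rewrite ltn_modp monic_neq0 // char_poly_monic.
Qed.

(** * From a positive vector to herdability *)

Lemma exists_scale_ge (R : realFieldType) (I : finType) (P : pred I)
    (y w : I -> R) (h : R) :
  (forall i, P i -> 0 < w i) ->
  exists a, forall i, P i -> h <= y i + a * w i.
Proof.
move=> w_gt0.
(* The i-th term alone suffices for i; the other terms only help. *)
exists (\sum_(i | P i) `|h - y i| / w i) => i Pi.
rewrite -lerBlDl -ler_pdivrMr ?w_gt0 // (bigD1 i) //=.
apply: (@le_trans _ _ (`|h - y i| / w i)).
  by apply: ler_wpM2r; [rewrite invr_ge0 ltW ?w_gt0|exact: ler_norm].
rewrite lerDl; apply: sumr_ge0 => j /andP[Pj _].
by rewrite divr_ge0 ?normr_ge0 // ltW ?w_gt0.
Qed.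

Lemma positive_ct_herdable (R : realType) (n : nat) (A : 'M[R]_n.+1)
    (b : 'cV[R]_n.+1) (q : {poly R}) :
  (forall i, 0 < (horner_mx A q *m b) i 0) -> ct_herdable A b.
Proof.
move=> q_gt0 x0 h _; set w := horner_mx A q *m b.
have [a a_ge] : exists a, forall i, true -> h <= flow A x0 1 i 0 + a * w i 0.
  exact: exists_scale_ge.
have [u [z [uC zD z0 z1]]] : steerable A b (a *: w).
  exact/steerableZ/steerable_horner.
pose x t := flow A x0 t + z t.
have xD (t : R) : is_derive t 1 x (A *m x t + b *m (u t *: 1%:M)).
  rewrite -scalemxAr mulmx1 mulmxDr -addrA.
  by apply: is_deriveD; exact: is_derive_flow.
exists 1, (fun t => u t *: 1%:M), x; split => //.
- split => //.
  + apply: continuous_subspaceT => t; apply: continuousZl; exact: uC.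
  + by apply: continuous_subspaceT; exact: is_derive_continuous xD.
- by rewrite /x flow0 z0 addr0.
- by move=> i; rewrite /x z1 [leRHS]mxE [X in _ + X]mxE; exact: a_ge.
Qed.

(** Appending the input a c to a sequence of inputs for q multiplies the forced
    part by A and adds a c b: this is the Horner step q X + c.  The number of
    steps depends on q only, so that a may be chosen afterwards, when the free
    evolution is known. *)
Lemma dt_reach_horner (R : realType) (n : nat) (A : 'M[R]_n.+1)
    (b : 'cV[R]_n.+1) (q : {poly R}) :
  exists2 N, (0 < N)%N & forall (x0 : 'cV[R]_n.+1) (a : R),
    exists (u : nat -> 'cV[R]_1) (x : nat -> 'cV[R]_n.+1),
      [/\ dt_trajectory A b N u x, x 0%N = x0 &
          x N = A ^+ N *m x0 + a *: (horner_mx A q *m b)].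
Proof.
elim/poly_ind: q => [|q c [N N_gt0 IHq]].
  exists 1%N => // x0 a.
  exists (fun=> 0), (fun t => if t is 0%N then x0 else A *m x0); split => //.
    by case=> // _; rewrite mulmx0 addr0.
  by rewrite expr1 rmorph0 mul0mx scaler0 addr0.
exists N.+1 => // x0 a; have [u [x [xE x_0 xN]]] := IHq x0 a.
pose last_u := (a * c) *: (1%:M : 'cV[R]_1).
exists (fun t => if t == N then last_u else u t).
exists (fun t => if (t <= N)%N then x t else A *m x N + b *m last_u).
split => [t|//|].
  rewrite ltnS leq_eqVlt; case: eqP => [->|_] /= ltN.
    by rewrite ltnn.
  by rewrite ltN; exact: xE.
rewrite ltnn xN mulmxDr mulmxA exprS -addrA; congr (_ + _).
rewrite -!scalemxAr mulmx1 rmorphD rmorphM /= horner_mx_X horner_mx_C.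
rewrite mulmxDl scalerDr mul_scalar_mx scalerA; congr (_ *: _ + _).
rewrite mulmxA; congr (_ *m _).
rewrite -[RHS]/(horner_mx A q *m A); apply/esym/comm_horner_mx.
exact: comm_mx_refl.
Qed.

Lemma positive_dt_herdable (R : realType) (n : nat) (A : 'M[R]_n.+1)
    (b : 'cV[R]_n.+1) (q : {poly R}) :
  (forall i, 0 < (horner_mx A q *m b) i 0) -> dt_herdable A b.
Proof.
move=> q_gt0 x0 h _; set w := horner_mx A q *m b.
have [N N_gt0 reach] := dt_reach_horner A b q.
have [a a_ge] : exists a, forall i, true -> h <= (A ^+ N *m x0) i 0 + a * w i 0.
  exact: exists_scale_ge.
have [u [x [xE x_0 xN]]] := reach x0 a.
exists N, u, x; split=> // i; rewrite xN [leRHS]mxE [X in _ + X]mxE.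
exact: a_ge.
Qed.

(** * Graph distance *)

Lemma has_walkP (T : finType) (e : rel T) (x y : T) (k : nat) :
  reflect (exists p, [/\ size p = k, path e x p & last x p = y])
    (has_walk e x y k).
Proof.
apply: (iffP existsP) => [[p /andP[xp /eqP]]|[p [<- xp lastp]]].
  by exists p; rewrite size_tuple.
by exists (in_tuple p); rewrite xp lastp eqxx.
Qed.

Lemma graph_dist_le (T : finType) (e : rel T) (x y : T) (k : nat) :
  has_walk e x y k -> (graph_dist e x y <= k)%N.
Proof.
move=> walk; rewrite leqNgt; apply/negP => ltk.
have /(before_find 0%N) := ltk; rewrite nth_iota ?walk //.
by apply: leq_trans ltk _; rewrite -[leqRHS](size_iota 0) find_size.
Qed.

(** A walk without repeated vertices has length below the number of vertices,
    hence it is found by the bounded search that defines the distance. *)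
Lemma graph_dist_walk (T : finType) (e : rel T) (x y : T) :
  connect e x y -> has_walk e x y (graph_dist e x y).
Proof.
move=> /connectP[p /shortenP[p' xp' uniq_p' _] ->].
set y' := last x p'.
have lt_size : (size p' < #|T|)%N.
  by rewrite -[X in (X <= _)%N]/(size (x :: p')) -(card_uniqP uniq_p') max_card.
have found : has (has_walk e x y') (iota 0 #|T|).
  apply/hasP; exists (size p'); first by rewrite mem_iota.
  by apply/has_walkP; exists p'.
have := nth_find 0%N found; rewrite nth_iota //.
by move: found; rewrite has_find size_iota.
Qed.

Lemma graph_dist0 (T : finType) (e : rel T) (x : T) : graph_dist e x x = 0%N.
Proof.
apply/eqP; rewrite -leqn0; apply: graph_dist_le.
by apply/has_walkP; exists [::].
Qed.

Lemma graph_dist_edge (T : finType) (e : rel T) (r x y : T) :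
  connect e r x -> e x y -> (graph_dist e r y <= (graph_dist e r x).+1)%N.
Proof.
move=> /graph_dist_walk/has_walkP[p [sz rp lastp]] exy.
apply/graph_dist_le/has_walkP; exists (rcons p y).
by rewrite size_rcons sz rcons_path rp lastp exy last_rcons.
Qed.

Lemma graph_dist_eq0 (T : finType) (e : rel T) (r y : T) :
  connect e r y -> graph_dist e r y = 0%N -> y = r.
Proof. by move=> /graph_dist_walk/[swap]-> /has_walkP[[|? ?] []]. Qed.

Lemma graph_dist_pred (T : finType) (e : rel T) (r y : T) (k : nat) :
  connect e r y -> graph_dist e r y = k.+1 ->
  exists2 x, e x y & graph_dist e r x = k.
Proof.
move=> /graph_dist_walk/has_walkP[p [sz rp lastp]] dy.
case/lastP: p sz rp lastp => [|p z]; first by rewrite dy.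
rewrite dy size_rcons rcons_path last_rcons => -[sz] /andP[rp ez] zy.
rewrite {z}zy in ez; exists (last r p) => //.
apply/eqP; rewrite eqn_leq; apply/andP; split.
  by apply/graph_dist_le/has_walkP; exists p.
rewrite -ltnS -dy; apply: graph_dist_edge ez.
by apply/connectP; exists p.
Qed.

(** * A positive vector from one-signed layers *)

(** In this part d stands for the distance to the leader, known only through its
    behaviour along the arcs of A. *)

Lemma powM_far_eq0 (R : realType) (n : nat) (A : 'M[R]_n.+1)
    (b : 'cV[R]_n.+1) (d : 'I_n.+1 -> nat) :
  (forall i, (0 < d i)%N -> b i 0 = 0) ->
  (forall i j, A j i != 0 -> (d j <= (d i).+1)%N) ->
  forall k i, (k < d i)%N -> (A ^+ k *m b) i 0 = 0.
Proof.
move=> b_far A_step; elim=> [|k IHk] i ltki.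
  by rewrite expr0 mul1mx b_far.
rewrite exprS -mulmxA mxE big1 // => j _.
have [->|Aij] := eqVneq (A i j) 0; first by rewrite mul0r.
by rewrite IHk ?mulr0 // -ltnS (leq_trans ltki) // A_step.
Qed.

(** The sign s of layer k.+1 is that of layer k times the weight of any edge
    between the two layers.  A vertex of layer k.+1 receives nothing from beyond
    layer k and only contributions of sign s from layer k, at least one of which
    is not zero, by the existence of a predecessor. *)
Lemma powM_layer_sign (R : realType) (n : nat) (A : 'M[R]_n.+1)
    (b : 'cV[R]_n.+1) (d : 'I_n.+1 -> nat) :
  (forall i, d i = 0%N -> 0 < b i 0) ->
  (forall i, (0 < d i)%N -> b i 0 = 0) ->
  (forall i j, A j i != 0 -> (d j <= (d i).+1)%N) ->
  (forall j k, d j = k.+1 -> exists2 i, A j i != 0 & d i = k) ->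
  (forall i j i' j', d i = d i' -> d j = (d i).+1 -> d j' = (d i').+1 ->
     A j i != 0 -> A j' i' != 0 -> 0 < A j i * A j' i') ->
  forall k, exists s, forall i, d i = k -> 0 < s * (A ^+ k *m b) i 0.
Proof.
move=> b_root b_far A_step A_pred A_sign; elim=> [|k [s s_gt0]].
  by exists 1 => i di; rewrite mul1r expr0 mul1mx b_root.
have [/existsP[j0 /eqP dj0]|/existsPn no_layer] := boolP [exists j, d j == k.+1];
  last by exists 1 => i di; have := no_layer i; rewrite di eqxx.
have [i0 A0 di0] := A_pred _ _ dj0.
exists (A j0 i0 * s) => j dj.
have [i1 A1 di1] := A_pred _ _ dj.
rewrite exprS -mulmxA mxE mulr_sumr.
have term i : 0 <= A j0 i0 * s * (A j i * (A ^+ k *m b) i 0).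
  rewrite mulrACA; have [->|Aji] := eqVneq (A j i) 0; first by rewrite mulr0 mul0r.
  have [di|ne_di] := eqVneq (d i) k.
    by rewrite ltW // mulr_gt0 ?s_gt0 // A_sign ?di0 ?di.
  have lt_ki : (k < d i)%N.
    by rewrite ltn_neqAle eq_sym ne_di -ltnS -dj A_step.
  by rewrite (powM_far_eq0 b_far A_step lt_ki) !mulr0.
rewrite (bigD1 i1) //=; apply: ltr_wpDr; first exact: sumr_ge0.
by rewrite mulrACA mulr_gt0 ?s_gt0 // A_sign ?di0 ?di1.
Qed.

(** Positivity is extended from the farthest layers inwards: the vector A^k b that
    corrects layer k is zero on the layers already treated. *)
Lemma layered_positive (R : realType) (n : nat) (A : 'M[R]_n.+1)
    (b : 'cV[R]_n.+1) (d : 'I_n.+1 -> nat) :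
  (forall k i, (k < d i)%N -> (A ^+ k *m b) i 0 = 0) ->
  (forall k, exists s, forall i, d i = k -> 0 < s * (A ^+ k *m b) i 0) ->
  exists q, forall i, 0 < (horner_mx A q *m b) i 0.
Proof.
move=> far sign.
pose K := \max_i d i.
suff /(_ K.+1 (leqnn _)) [q q_gt0] : forall m, (m <= K.+1)%N ->
    exists q : {poly R}, forall i, (K < d i + m)%N ->
      0 < (horner_mx A q *m b) i 0.
  by exists q => i; apply: q_gt0; lia.
elim=> [|m IHm] lemK.
  exists 0 => i; rewrite addn0 ltnNge.
  by rewrite -[X in ~~ X]/((d i <= \max_i' d i')%N) leq_bigmax.
have [q q_gt0] := IHm (ltnW lemK).
have [s s_gt0] := sign (K - m)%N.
(* The threshold 1 stands for any positive number. *)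
have [a a_ge] := exists_scale_ge (P := fun i => d i == (K - m)%N)
  (fun i => (horner_mx A q *m b) i 0) 1 (fun i di => s_gt0 i (eqP di)).
have new_entry i : (horner_mx A (q + (a * s) *: 'X^(K - m)) *m b) i 0
    = (horner_mx A q *m b) i 0 + a * (s * (A ^+ (K - m) *m b) i 0).
  rewrite rmorphD /= linearZ /= rmorphXn /= horner_mx_X mulmxDl mxE.
  by rewrite -scalemxAl [X in _ + X]mxE mulrA.
exists (q + (a * s) *: 'X^(K - m)) => i ltKi; rewrite new_entry.
have [di|ne_di] := eqVneq (d i) (K - m)%N.
  by apply: lt_le_trans ltr01 _; apply: a_ge; rewrite di.
rewrite far ?mulr0 ?addr0; last by lia.
by apply: q_gt0; lia.
Qed.

Theorem proposition11 (R : realType) (n : nat) (A : 'M[R]_n.+1)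
    (A_sym : A^T = A)
    (G_connected : graph_connected (mx_graph A))
    (G_acyclic : graph_acyclic (mx_graph A))
    (numbering : numbered_by_distance (mx_graph A))
    (same_sign : forall k : nat, (k < graph_height (mx_graph A) ord0)%N ->
      forall i j i' j' : 'I_n.+1,
        i \in layer (mx_graph A) ord0 k ->
        j \in layer (mx_graph A) ord0 k.+1 -> mx_graph A i j ->
        i' \in layer (mx_graph A) ord0 k ->
        j' \in layer (mx_graph A) ord0 k.+1 -> mx_graph A i' j' ->
        Num.sg (A j i) = Num.sg (A j' i')) :
  ct_herdable A (delta_mx ord0 ord0 : 'cV[R]_n.+1) /\
  dt_herdable A (delta_mx ord0 ord0 : 'cV[R]_n.+1).
Proof.
set b := delta_mx _ _; pose d := graph_dist (mx_graph A) ord0.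
have b_root i : d i = 0%N -> 0 < b i 0.
  by move/(graph_dist_eq0 (G_connected _ _)) => ->; rewrite mxE !eqxx ltr01.
have b_far i : (0 < d i)%N -> b i 0 = 0.
  rewrite mxE; case: eqP => [->|//]; by rewrite /d graph_dist0.
have A_step i j : A j i != 0 -> (d j <= (d i).+1)%N.
  exact: graph_dist_edge.
have A_pred j k : d j = k.+1 -> exists2 i, A j i != 0 & d i = k.
  exact: graph_dist_pred.
have A_sign i j i' j' : d i = d i' -> d j = (d i).+1 -> d j' = (d i').+1 ->
    A j i != 0 -> A j' i' != 0 -> 0 < A j i * A j' i'.
  move=> dii' dj dj' Aji Aji'.
  have ltd : (d i < graph_height (mx_graph A) ord0)%N.
    by rewrite -dj /graph_height (bigD1 j) //= leq_maxl.
  have := same_sign _ ltd i j i' j'.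
  rewrite !inE -!/(d _) dj dj' dii' !eqxx => /(_ isT isT Aji isT isT Aji') eq_sg.
  rewrite -sgr_gt0 sgrM eq_sg -sgrM sgr_gt0 -expr2.
  by rewrite exprn_even_gt0.
have [q q_gt0] : exists q, forall i, 0 < (horner_mx A q *m b) i 0.
  apply: (@layered_positive _ _ _ _ d); first exact: powM_far_eq0.
  exact: powM_layer_sign.
by split; [exact: positive_ct_herdable q_gt0|exact: positive_dt_herdable q_gt0].
Qed.
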